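(* Let $W\in\mathbb{R}^{n\times n}$ be an invertible, normalized diagonally dominant matrix, and let $A=(\operatorname{diag}(W))^{-1}$ and $B=I_{n\times n}-(\operatorname{diag}(W))^{-1}W$. Then there exist constants $c_1>0$ and $0<c_2<1$ (depending only on $W$) such that the algorithm SS-Iterative $\epsilon$-always converges with $$\epsilon(\Delta t,\delta,\mathcal{C})=\delta c_1+(c_2)^{\Delta t}\,\|O(r)-\mathbf{u}\|_\infty .$$ Explicitly: for every $\delta\ge 0$, every $\mathbf{v}\in\mathbb{R}^n$, every starting round $r$ and every starting configuration $O(r)\in\mathbb{R}^n$, and every sequence of input vectors $I(r+1),I(r+2),\dots$ in $\mathbb{R}^n$ that is $\delta$-bounded around $\mathbf{v}$, if $\mathbf{u}$ is the unique solution of $W\mathbf{u}=\mathbf{v}$ and the outputs are generated by $$O(r+k+1)=A\,I(r+k+1)+B\,O(r+k)\qquad (k\ge 0),$$ then for every $\Delta t\ge 1$, $$\|O(r+\Delta t)-\mathbf{u}\|_\infty\le \delta c_1+(c_2)^{\Delta t}\,\|O(r)-\mathbf{u}\|_\infty .$$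
   Context: A matrix $M\in\mathbb{R}^{n\times n}$ is diagonally dominant if $|M_{ii}|>\sum_{j\neq i}|M_{ij}|$ for every $i$; it is normalized diagonally dominant if in addition $|M_{ii}|\ge 1$ for every $i$. Here $\operatorname{diag}(W)$ is the diagonal matrix with the same diagonal as $W$, and $\|\mathbf{x}\|_\infty=\max_i|\mathbf{x}_i|$. A sequence of vectors $\mathbf{v}(1),\mathbf{v}(2),\dots$ in $\mathbb{R}^n$ is $\delta$-bounded around $\mathbf{v}$ if $\|\mathbf{v}(i)-\mathbf{v}\|_\infty\le\delta$ for every $i$. SS-Iterative is a synchronous distributed algorithm on nodes $p_1,\dots,p_n$: in each round every node sends its current output to its neighbours, reads its current (possibly time-varying) scalar input, and sets its new output to the weighted sum of its input (weight $A_{ii}$) and the previous-round outputs of its neighbours $p_j$ (weights $B_{ij}$). In matrix form, with input vector $I(r)$ and output vector $O(r)$ at round $r$, the update is $O(r+1)=A\,I(r+1)+B\,O(r)$. The state (configuration $\mathcal{C}$) of the system at the start of round $r+1$ is determined by the vector $O(r)$, which may be arbitrary. The solution associated with a constant input $\mathbf{v}$ is the vector $\mathbf{u}$ with $\mathbf{u}=A\mathbf{v}+B\mathbf{u}$, equivalently $W\mathbf{u}=\mathbf{v}$. An algorithm $\epsilon$-always converges if, for every $\delta$-bounded input sequence around any $\mathbf{v}$ and every initial configuration $\mathcal{C}$, the output after $\Delta t$ rounds is within $\|\cdot\|_\infty$-distance $\epsilon(\Delta t,\delta,\mathcal{C})$ of the solution $\mathbf{u}$ for $\mathbf{v}$.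 *)

(* Defs.v *)
(* On 'cV[R]_n the library norm `|x| is the max norm: see [mx_normrE] in
   matrix_normedtype.v. *)
From mathcomp Require Export all_boot all_order all_algebra.
From mathcomp Require Export reals topology normedtype.

Set Implicit Arguments.
Unset Strict Implicit.
Unset Printing Implicit Defensive.

Export Order.TTheory GRing.Theory Num.Theory.
Export numFieldNormedType.Exports.

Local Open Scope ring_scope.

Definition diagonally_dominant (R : realType) (n : nat) (M : 'M[R]_n) : Prop :=
  forall i, \sum_(j | j != i) `|M i j| < `|M i i|.

Definition normalized_diagonally_dominant (R : realType) (n : nat)
    (M : 'M[R]_n) : Prop :=
  diagonally_dominant M /\ forall i, 1 <= `|M i i|.

Definition diag_part (R : realType) (n : nat) (W : 'M[R]_n) : 'M[R]_n :=
  diag_mx (\row_i W i i).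

(* Sequences of vectors are numbered from 1; the value at 0 is junk. *)
Definition delta_bounded (R : realType) (n : nat) (delta : R) (v : 'cV[R]_n)
    (s : nat -> 'cV[R]_n) : Prop :=
  forall i, (0 < i)%N -> `|s i - v| <= delta.

(* A synchronous algorithm with vector inputs and outputs is given by its
   one-round update: [alg x o] is the new output vector when [x] is the input
   vector read in this round and [o] is the previous output vector. The
   configuration at the start of round r+1 is the vector O r. *)
Definition algorithm (R : realType) (n : nat) : Type :=
  'cV[R]_n -> 'cV[R]_n -> 'cV[R]_n.

Definition execution (R : realType) (n : nat) (alg : algorithm R n) (r : nat)
    (I O : nat -> 'cV[R]_n) : Prop :=
  forall k, O (r + k).+1 = alg (I (r + k).+1) (O (r + k)%N).

Definition ss_iterative (R : realType) (n : nat) (A B : 'M[R]_n) :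
    algorithm R n :=
  fun x o => A *m x + B *m o.

(* [solution v u]: u is the solution associated with the constant input v.
   The last two arguments of [eps] are the starting configuration and u. *)
Definition always_converges (R : realType) (n : nat) (alg : algorithm R n)
    (solution : 'cV[R]_n -> 'cV[R]_n -> Prop)
    (eps : nat -> R -> 'cV[R]_n -> 'cV[R]_n -> R) : Prop :=
  forall (delta : R) (v u : 'cV[R]_n) (r : nat) (I O : nat -> 'cV[R]_n),
    0 <= delta ->
    solution v u ->
    delta_bounded delta v (fun i => I (r + i)%N) ->
    execution alg r I O ->
    forall dt : nat, (1 <= dt)%N ->
      `|O (r + dt)%N - u| <= eps dt delta (O r) u.

(* Main.v *)
(* One round of SS-Iterative maps the previous output error y and the current
   input error x to the output error A x + B y. Row i of diag(W) times this
   vector is [x_i - \sum_(j != i) W_ij y_j], so by dominance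
   [|A x + B y| <= |x| + c2 |y|], c2 being the largest ratio of an off-diagonal
   row sum to the diagonal entry. Iterating, the input errors add up to a
   geometric series bounded by [1 / (1 - c2)]. *)
Require Import Defs.
From mathcomp Require Import ring lra.

Local Open Scope ring_scope.

Lemma mx_norm_coord (R : realType) (m n : nat) (x : 'M[R]_(m, n)) i j :
  `|x i j| <= `|x|.
Proof.
by rewrite [leRHS]mx_normrE (le_bigmax _ (fun ij => `|x ij.1 ij.2|) (i, j)).
Qed.

(** [0 <= c] covers matrices without entries, whose norm is 0. *)
Lemma mx_norm_le (R : realType) (m n : nat) (x : 'M[R]_(m, n)) (c : R) :
  0 <= c -> (forall i j, `|x i j| <= c) -> `|x| <= c.
Proof. by move=> c0 xc; rewrite [leLHS]mx_normrE; apply: bigmax_le => // -[i j] _. Qed.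

(** Multiplying by [diag_part W] cancels its inverse and leaves [x + diag_part W *m y - W *m y],
    where the diagonal term of [W *m y] drops out. *)
Lemma jacobi_coord (R : realType) (n : nat) (W : 'M[R]_n) (x y : 'cV[R]_n) i :
  (forall k, W k k != 0) ->
  W i i * (invmx (diag_part W) *m x
           + (1%:M - invmx (diag_part W) *m W) *m y) i 0
  = x i 0 - \sum_(j | j != i) W i j * y j 0.
Proof.
move=> W0.
have uD : diag_part W \in unitmx.
  rewrite unitmxE det_diag unitfE prodf_seq_neq0.
  by apply/allP => k _; rewrite mxE W0.
have : diag_part W *m (invmx (diag_part W) *m x
         + (1%:M - invmx (diag_part W) *m W) *m y)
       = x + diag_part W *m y - W *m y.
  by rewrite mulmxDr mulKVmx // mulmxBl mul1mx mulmxBr -mulmxA mulKVmx // addrA.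
move=> /matrixP /(_ i 0); rewrite {1 3}/diag_part !mul_diag_mx mxE mxE => ->.
by rewrite !mxE (bigD1 i) //= opprD addrA addrK.
Qed.

Lemma normr_jacobi_step (R : realType) (n : nat) (W : 'M[R]_n) (c : R)
    (x y : 'cV[R]_n) :
  (forall i, 1 <= `|W i i|) -> 0 <= c ->
  (forall i, \sum_(j | j != i) `|W i j| <= c * `|W i i|) ->
  `|invmx (diag_part W) *m x + (1%:M - invmx (diag_part W) *m W) *m y|
    <= `|x| + c * `|y|.
Proof.
move=> W1 c0 Wc.
have Wgt0 k : 0 < `|W k k| by exact: lt_le_trans (W1 k).
apply: mx_norm_le => [|i j]; first by rewrite addr_ge0 ?mulr_ge0.
rewrite (ord1 j) -(ler_pM2l (Wgt0 i)) -normrM jacobi_coord; last first.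
  by move=> k; rewrite -normr_gt0.
apply: le_trans (ler_normB _ _) _; rewrite mulrDr; apply: lerD.
  (* Normalization enters here: [1 <= |W i i|] gives [|x| <= |W i i| * |x|]. *)
  by apply: le_trans (mx_norm_coord _ _ _ x i 0) _; rewrite ler_peMl.
rewrite mulrA; apply: le_trans (ler_norm_sum _ _ _) _.
apply: (@le_trans _ _ ((\sum_(j | j != i) `|W i j|) * `|y|)).
  rewrite mulr_suml; apply: ler_sum => k _.
  by rewrite normrM ler_wpM2l ?mx_norm_coord.
by rewrite ler_wpM2r // mulrC Wc.
Qed.

(** [d * (1 - c)^-1] is the fixed point of [t |-> d + c * t], so the induction avoids partial
    sums. *)
Lemma affine_recurrence_bound (R : realType) (e : nat -> R) (d c : R) (k : nat) :
  0 <= d -> c < 1 ->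
  (forall j, e j.+1 <= d + c * e j) -> 0 <= c ->
  e k <= d * (1 - c)^-1 + c ^+ k * e 0%N.
Proof.
move=> d0 c1 step c0; elim: k => [|k IH].
  by rewrite expr0 mul1r lerDr mulr_ge0 // invr_ge0 subr_ge0 ltW.
apply: le_trans (step k) _.
have -> : d * (1 - c)^-1 = d + c * (d * (1 - c)^-1).
  by field; rewrite subr_eq0 gt_eqF.
rewrite exprS -mulrA -addrA -mulrDr lerD2l.
by rewrite ler_wpM2l.
Qed.

Theorem theorem1 (R : realType) (n : nat) (W : 'M[R]_n) :
  W \in unitmx ->
  normalized_diagonally_dominant W ->
  let A := invmx (diag_part W) in
  let B := 1%:M - invmx (diag_part W) *m W in
  exists c1 c2 : R,
    [/\ 0 < c1, 0 < c2 < 1 &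
      always_converges (ss_iterative A B)
        (fun v u => W *m u = v)
        (fun dt delta o u => delta * c1 + c2 ^+ dt * `|o - u|)].
Proof.
move=> _ [Wdom W1] A B.
have Wgt0 i : 0 < `|W i i| by exact: lt_le_trans (W1 i).
(* The ratios may all vanish (or n = 0), so 1/2 is put in to keep c2 positive. *)
pose c := \big[Num.max/(2^-1 : R)]_i ((\sum_(j | j != i) `|W i j|) / `|W i i|).
have c_gt0 : 0 < c.
  by apply: lt_le_trans (bigmax_ge_id _ _ _ _); rewrite invr_gt0.
have c_lt1 : c < 1.
  apply: bigmax_lt => [|i _]; first by lra.
  by rewrite ltr_pdivrMr // mul1r Wdom.
exists (1 - c)^-1, c; split; [by rewrite invr_gt0 subr_gt0|by rewrite c_gt0|].
move=> d v u r I O d0 Wu Iv OI k _.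
pose e j := `|O (r + j)%N - u|.
suff : e k <= d * (1 - c)^-1 + c ^+ k * e 0%N by rewrite /e addn0.
apply: affine_recurrence_bound => //; last exact: ltW.
move=> j; rewrite /e addnS OI /ss_iterative.
(* Subtracting [u = A *m v + B *m u] from the update makes the errors obey the same linear rule. *)
have -> : A *m I (r + j).+1 + B *m O (r + j)%N - u
    = A *m (I (r + j).+1 - v) + B *m (O (r + j)%N - u).
  have uE : u = A *m v + B *m u by rewrite mulmxBl mul1mx -mulmxA Wu addrC subrK.
  by rewrite {1}uE !mulmxBr opprD addrACA.
apply: le_trans (normr_jacobi_step _ _ _ c _ _ W1 (ltW c_gt0) _) _ => //.
  by move=> i; rewrite -ler_pdivrMr // (le_bigmax _ _ i).
(* The input read here has index [j.+1] in the shifted sequence, so the junk value at 0 is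
   avoided. *)
by rewrite lerD2r -addnS Iv.
Qed.
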